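(* Every modular Stanley sequence follows Type 1 growth. That is, if $S(A)=(a_n)_{n\ge0}$ is a modular Stanley sequence modulo $N$ for some positive integer $N$, then there is a real constant $\alpha>0$ such that $$\frac{\alpha}{2}\le\liminf_{n\to\infty}\frac{a_n}{n^{\log_23}}\le\limsup_{n\to\infty}\frac{a_n}{n^{\log_23}}\le\alpha.$$
   Context: A set of integers is 3-free if it contains no three distinct terms in arithmetic progression. For a finite 3-free set $A=\{a_0<\cdots<a_k\}$ of nonnegative integers, the Stanley sequence $S(A)=(a_n)_{n\ge 0}$ is defined greedily: once $a_0<\cdots<a_n$ (with $n\ge k$) are defined, $a_{n+1}$ is the smallest integer greater than $a_n$ such that $\{a_0,\ldots,a_{n+1}\}$ is 3-free. For a positive integer $N$ and $A'\subseteq\{0,\ldots,N-1\}$: $A'$ is 3-free modulo $N$ if there are no $x,y,z\in A'$, not all equal, with $2y-z\equiv x\pmod N$; an integer $x$ is covered by $A'$ modulo $N$ if there exist $y,z\in A'$ with $z<y$ and $2y-z\equiv x\pmod N$. $A'$ is a modular set modulo $N$ if $0\in A'\subseteq\{0,\ldots,N-1\}$, $A'$ is 3-free modulo $N$, and every $x\in\{0,\ldots,N-1\}\setminus A'$ is covered by $A'$ modulo $N$. A sequence is a modular Stanley sequence modulo $N$ if it equals $S(A')$ for some modular set $A'$ modulo $N$. *)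

(* Defs.v *)
From mathcomp Require Import all_boot all_order all_algebra finmap.
From mathcomp Require Import all_classical all_reals all_analysis.

Set Implicit Arguments.
Unset Strict Implicit.
Unset Printing Implicit Defensive.

Import Order.TTheory GRing.Theory Num.Theory.

Local Open Scope classical_set_scope.
Local Open Scope ring_scope.

(* The progression x, y, z has middle term y. Only sets of nonnegative
   integers occur. *)
Definition three_free (A : set nat) : Prop :=
  forall x y z : nat, A x -> A y -> A z ->
    x <> y -> y <> z -> x <> z -> (x + z)%N <> (2 * y)%N.

(* [stanley A a] says that a = S(A), for A finite, nonempty and 3-free.
   With k.+1 = #|` A |, the greedy rule applies at every n >= k. *)
Definition stanley (A : {fset nat}) (a : nat -> nat) : Prop :=
  (forall n, (n < #|` A |)%N -> a n = nth 0%N (sort leq A) n) /\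
  (forall n, (#|` A | <= n.+1)%N ->
     [/\ (a n < a n.+1)%N,
         three_free (a @` `I_n.+2) &
         forall m, (a n < m)%N -> three_free (a @` `I_n.+1 `|` [set m]) ->
           (a n.+1 <= m)%N]).

Definition three_free_mod (N : nat) (A : {fset nat}) : Prop :=
  forall x y z : nat, x \in A -> y \in A -> z \in A ->
    ~ (x = y /\ y = z) -> (2 * y%:Z - z%:Z <> x%:Z %[mod N])%Z.

Definition covered_mod (N : nat) (A : {fset nat}) (x : int) : Prop :=
  exists y z : nat, [/\ y \in A, z \in A, (z < y)%N &
    (2 * y%:Z - z%:Z = x %[mod N])%Z].

Definition modular_set (N : nat) (A : {fset nat}) : Prop :=
  [/\ 0%N \in A,
      forall x : nat, x \in A -> (x < N)%N,
      three_free_mod N A &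
      forall x : nat, (x < N)%N -> x \notin A -> covered_mod N A x%:Z].

Definition modular_stanley (N : nat) (a : nat -> nat) : Prop :=
  exists A : {fset nat}, modular_set N A /\ stanley A a.

(* The term at n = 0 has denominator 0 `^ (ln 3 / ln 2) = 0 and is 0 by
   convention; it does not affect the limits. *)
Definition growth_ratio (R : realType) (a : nat -> nat) (n : nat) : R :=
  (a n)%:R / n%:R `^ (ln 3 / ln 2).

Definition type1_growth (R : realType) (a : nat -> nat) : Prop :=
  exists alpha : R, 0 < alpha /\
    ((alpha / 2)%:E <= limn_einf (fun n => (growth_ratio R a n)%:E) /\
     limn_einf (fun n => (growth_ratio R a n)%:E)
       <= limn_esup (fun n => (growth_ratio R a n)%:E) /\
     limn_esup (fun n => (growth_ratio R a n)%:E) <= alpha%:E)%E.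

(* Main.v *)
Require Import Defs.
From mathcomp Require Import all_boot all_order all_algebra finmap.
From mathcomp Require Import all_classical all_reals all_analysis.
From mathcomp Require Import zify ring lra.

(** Write [t q] for the number obtained by reading the binary digits of [q] in
    base 3 ([ternary]).  Its values, the numbers without digit 2 in base 3, form
    the greedy sequence S({0}): solving x + z = 2y digit by digit never produces
    a carry, so they contain no nontrivial progression
    ([ternary_three_free]), and every number is 2y - z for two of them, since
    each of the digits 0, 1, 2 is 2e - f for some e, f in {0, 1} with f <= e
    ([ternary_cover]).

    A modular set A = {b_0 < ... < b_(m-1)} modulo N blows this up by the factor
    N: S(A) is the set of all N t(q) + b, with q a natural number and b in A, that is,
    a_(mq+i) = N t(q) + b_i ([modular_stanleyE]).  Reducing a progression modulo
    N forces its residues to be equal and leaves a progression of values of t;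
    conversely a number outside this set is the third term of a progression
    inside it, its residue being dealt with by the covering property of A and
    its quotient by that of t.  A greedy sequence is determined by these two
    properties ([stanley_unique]).

    So growth is a question about t, for which t(2q+e) = 3 t(q) + e.  With
    L = log_2 3, so that 2^L = 3, this recursion matches that of x^L up to
    terms controlled by the convexity of x^L, and yields

      ((q+1)^L - 1) / 2 <= t(q) <= q^L

    ([powR_le_ternary], [ternary_le_powR]), with equality on the left at
    q = 2^k - 1 and on the right at q = 2^k.  With q = floor(n/m) it follows
    that a_n / n^L lies between alpha/2 - N/n and alpha + N/n for
    alpha = N / m^L. *)

Set Implicit Arguments.
Unset Strict Implicit.
Unset Printing Implicit Defensive.

Import Order.TTheory GRing.Theory Num.Theory.
Import numFieldNormedType.Exports.
Local Open Scope classical_set_scope.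

(** * The numbers without digit 2 in base 3 *)

(** The first argument bounds the number of digits read, which makes the
    recursion on halves structural; [ternaryE] is the recursion itself. *)
Fixpoint ternary_fuel (k n : nat) : nat :=
  if k is k'.+1 then (odd n + 3 * ternary_fuel k' n./2)%N else 0%N.

Definition ternary (n : nat) : nat := ternary_fuel n n.

Lemma ternary_fuelE (k n : nat) :
  (n <= k)%N -> ternary_fuel k n = ternary n.
Proof.
rewrite /ternary; elim/ltn_ind: k n => -[|k] IH [|n] //= nk.
- by have /= -> := IH k _ 0%N _.
- by rewrite !IH //; lia.
Qed.

Lemma ternaryE (n : nat) : ternary n = (odd n + 3 * ternary n./2)%N.
Proof.
case: n => [|n] //; rewrite {1}/ternary [LHS]/= ternary_fuelE //; lia.
Qed.

Lemma ternary_ltn (m n : nat) : (m < n)%N -> (ternary m < ternary n)%N.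
Proof.
elim/ltn_ind: n m => n IH m mn; rewrite (ternaryE m) (ternaryE n).
have [le_half|lt_half] := leqP n./2 m./2; first by have -> : m./2 = n./2; lia.
by have := IH n./2 ltac:(lia) _ lt_half; lia.
Qed.

Lemma ternary_leq (m n : nat) : (m <= n)%N -> (ternary m <= ternary n)%N.
Proof. by rewrite leq_eqVlt => /predU1P[->//|/ternary_ltn/ltnW]. Qed.

(** Modulo 3 the last digits satisfy e + g = 2f with e, f, g in {0, 1}, hence
    they agree and leave an equation of the same form on the halves. *)
Lemma ternary_three_free (u v w : nat) :
  (ternary u + ternary w = 2 * ternary v)%N -> u = v /\ v = w.
Proof.
have [n] := ubnP (u + v + w)%N; elim: n u v w => // n IH u v w le_n.
have [?|uvw_gt0] := posnP (u + v + w)%N; first by lia.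
rewrite (ternaryE u) (ternaryE v) (ternaryE w) => e.
by have := IH u./2 v./2 w./2 ltac:(lia) ltac:(lia); lia.
Qed.

Lemma ternary_cover (n : nat) :
  exists u v : nat, (v <= u)%N /\ (n + ternary v = 2 * ternary u)%N.
Proof.
elim/ltn_ind: n => n IH.
have [->|n0] := posnP n; first by exists 0%N, 0%N.
have [u [v [vu e]]] := IH (n %/ 3)%N ltac:(lia).
have [d0|[d1|d2]] : n %% 3 = 0%N \/ n %% 3 = 1%N \/ n %% 3 = 2%N by lia.
- exists u.*2, v.*2; split; first lia.
  by rewrite (ternaryE u.*2) (ternaryE v.*2) !odd_double !doubleK; lia.
- exists u.*2.+1, v.*2.+1; split; first lia.
  by rewrite (ternaryE u.*2.+1) (ternaryE v.*2.+1) /= !odd_double !uphalf_double; lia.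
- exists u.*2.+1, v.*2; split; first lia.
  by rewrite (ternaryE u.*2.+1) (ternaryE v.*2) /= !odd_double !uphalf_double !doubleK; lia.
Qed.

(** * Modular Stanley sequences in closed form *)

(** The term [a n.+1] cannot exceed [c n.+1], which is an admissible choice, and
    cannot lie strictly between [c n] and [c n.+1], since a number missed by [c]
    closes a progression whose first two terms are already present. *)
Lemma stanley_unique (A : {fset nat}) (a c : nat -> nat) :
  (0 < #|` A |)%N ->
  (forall n, (n < #|` A |)%N -> c n = nth 0%N (sort leq A) n) ->
  {homo c : m n / (m < n)%N} ->
  three_free (range c) ->
  (forall x, (forall y, y \in A -> (y < x)%N) -> ~ range c x ->
    exists i j, (c i < c j)%N /\ (c i + x = 2 * c j)%N) ->
  stanley A a -> a =1 c.
Proof.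
move=> A0 cA c_lt c_free c_cover [aA a_greedy].
elim/ltn_ind=> -[|n] IH; first by rewrite aA// cA.
have [nA|An] := ltnP n.+1 #|` A |; first by rewrite aA// cA.
have [an_lt a_free a_min] := a_greedy n An.
have an : a n = c n by apply: IH.
have a_le : (a n.+1 <= c n.+1)%N.
  apply: a_min; first by rewrite an c_lt.
  have sub x : ((a @` `I_n.+1) `|` [set c n.+1]) x -> range c x.
    case=> [[i /= ilt <-]|/= ->]; last by exists n.+1.
    by exists i => //; rewrite IH.
  by move=> x y z /sub Ax /sub Ay /sub Az; apply: c_free.
apply/eqP; rewrite eqn_leq a_le leqNgt; apply/negP => a_lt.
have c_mono : {mono c : i j / (i <= j)%N} by exact: leq_mono.
have c_mono_lt := leqW_mono c_mono.
have [||i [j [ij e]]] := c_cover (a n.+1).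
- move=> y yA; have yA' : y \in sort leq A by rewrite mem_sort.
  have yi : (index y (sort leq A) < #|` A |)%N.
    by rewrite -(size_sort leq) index_mem.
  rewrite -(nth_index 0%N yA') -cA //.
  by apply: leq_ltn_trans an_lt; rewrite an c_mono -ltnS; apply: leq_trans An.
- by case=> i _ ci; move: an_lt a_lt; rewrite an -ci !c_mono_lt; lia.
- have jn : (j < n.+1)%N by rewrite -c_mono_lt; lia.
  have il : (i < j)%N by rewrite -c_mono_lt.
  apply: (a_free (c i) (c j) (a n.+1)) => //; try lia.
  + by exists i => /=; [|apply: IH]; lia.
  + by exists j => /=; [|apply: IH]; lia.
  + by exists n.+1 => /=; lia.
Qed.

(** Writing n = m q + i with i < m, this is N t(q) + b_i. *)
Definition digit_expansion (N : nat) (A : {fset nat}) (n : nat) : nat :=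
  (N * ternary (n %/ #|` A |) + nth 0 (sort leq A) (n %% #|` A |))%N.

Section ModularSet.
Variables (N : nat) (A : {fset nat}).
Hypothesis (A_mod : modular_set N A).

Let b := nth 0%N (sort leq A).
Let m := #|` A |.

Lemma modular_card_gt0 : (0 < m)%N.
Proof. by have [A0 _ _ _] := A_mod; rewrite cardfs_gt0; apply/fset0Pn; exists 0%N. Qed.

Lemma modular_nth_mem (i : nat) : (i < m)%N -> b i \in A.
Proof. by move=> im; rewrite -(mem_sort leq) mem_nth // size_sort. Qed.

Lemma modular_nth_ltn (i j : nat) : (i < j < m)%N -> (b i < b j)%N.
Proof.
move=> /andP[ij jm]; apply: (sorted_ltn_nth ltn_trans) => //.
- by rewrite ltn_sorted_uniq_leq sort_uniq fset_uniq sort_sorted //; apply: leq_total.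
- by rewrite inE size_sort; apply: ltn_trans jm.
- by rewrite inE size_sort.
Qed.

Lemma digit_expansion_homo : {homo digit_expansion N A : i j / (i < j)%N}.
Proof.
move=> i j ij; rewrite /digit_expansion -/m -/b.
have m0 := modular_card_gt0.
have bN k : (b (k %% m) < N)%N.
  by have [_ AN _ _] := A_mod; apply/AN/modular_nth_mem; rewrite ltn_mod.
have := leq_div2r m (ltnW ij); rewrite leq_eqVlt => /predU1P[eq_q|lt_q].
  rewrite eq_q ltn_add2l modular_nth_ltn // ltn_mod m0 andbT.
  by have := ij; rewrite {1}(divn_eq i m) {1}(divn_eq j m) eq_q ltn_add2l.
have := ternary_ltn lt_q; have := bN i; nia.
Qed.

Lemma digit_expansion_range (x : nat) : range (digit_expansion N A) x <->
  exists q r, r \in A /\ x = (N * ternary q + r)%N.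
Proof.
split=> [[n _ <-]|[q [r [rA ->]]]].
  exists (n %/ m), (b (n %% m)); split=> //.
  by apply: modular_nth_mem; rewrite ltn_mod modular_card_gt0.
have rA' : r \in sort leq A by rewrite mem_sort.
have rm : (index r (sort leq A) < m)%N by rewrite /m -(size_sort leq) index_mem.
exists (q * m + index r (sort leq A))%N => //; rewrite /digit_expansion -/m.
rewrite divnMDl ?modular_card_gt0 // modnMDl modn_small // divn_small // addn0.
by rewrite nth_index.
Qed.

(** The residues modulo N of a progression lie in [A], hence are all equal; the
    quotients then form a progression of values of [ternary]. *)
Lemma digit_expansion_three_free : three_free (range (digit_expansion N A)).
Proof.
move=> x y z /digit_expansion_range [u [i [iA ->]]].
move=> /digit_expansion_range [v [j [jA ->]]].
move=> /digit_expansion_range [w [k [kA ->]]] xy _ _ e; apply: xy.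
have [_ _ A_free _] := A_mod.
have [ij jk] : i = j /\ j = k.
  apply: contrapT => /(A_free i j k iA jA kA); apply.
  apply/eqP; rewrite eqz_mod_dvd; apply/dvdzP.
  by exists ((ternary u)%:Z + (ternary w)%:Z - 2 * (ternary v)%:Z)%R; nia.
have N0 : (0 < N)%N by have [_ /(_ _ iA)] := A_mod; lia.
have [-> _] : u = v /\ v = w by apply: ternary_three_free; nia.
by rewrite ij.
Qed.

(** As 0 < 2y - z < 2N, a covered residue [x] is 2y - z or 2y - z - N, so lifting
    it to the integers costs a carry [t] of at most 1. *)
Lemma covered_carry (x : nat) : (x < N)%N -> covered_mod N A x ->
  exists y z t : nat, [/\ y \in A, z \in A, (z < y)%N &
    (t <= 1 /\ z + x + t * N = 2 * y)%N].
Proof.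
have [_ AN _ _] := A_mod.
move=> xN [y [z [yA zA zy /eqP]]]; rewrite eqz_mod_dvd => /dvdzP [k ek].
have yN := AN y yA.
have [k0|k1] : (k = 0 \/ k = 1)%R by nia.
- by exists y, z, 0%N; split=> //; nia.
- by exists y, z, 1%N; split=> //; nia.
Qed.

(** For [x] with residue r in [A], cover the quotient only; otherwise cover r
    with a carry t and then cover the quotient minus t. *)
Lemma digit_expansion_cover (x : nat) :
  (forall y, y \in A -> (y < x)%N) -> ~ range (digit_expansion N A) x ->
  exists i j, (digit_expansion N A i < digit_expansion N A j)%N /\
    (digit_expansion N A i + x = 2 * digit_expansion N A j)%N.
Proof.
move=> Ax xNrange; have [A0 AN _ A_cover] := A_mod.
have N0 := AN 0%N A0.
suff [u [v [y [z [yA zA lt e]]]]] : exists u v y z, [/\ y \in A, z \in A,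
    (N * ternary v + z < N * ternary u + y)%N &
    (N * ternary v + z + x = 2 * (N * ternary u + y))%N].
  have [i _ ei] : range (digit_expansion N A) (N * ternary v + z)%N.
    by apply/digit_expansion_range; exists v, z.
  have [j _ ej] : range (digit_expansion N A) (N * ternary u + y)%N.
    by apply/digit_expansion_range; exists u, y.
  by exists i, j; rewrite ei ej.
have xq := divn_eq x N; have rN : (x %% N < N)%N by rewrite ltn_mod.
have [rA|rNA] := boolP ((x %% N)%N \in A).
  have [u [v [vu e]]] := ternary_cover (x %/ N)%N.
  (* If equal, the quotient would be a value of [ternary] and [x] in the range. *)
  have lt_vu : (ternary v < ternary u)%N.
    rewrite ltn_neqAle ternary_leq // andbT; apply: contra_notN xNrange => /eqP euv.
    apply/digit_expansion_range; exists u, (x %% N)%N; split=> //; nia.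
  by exists u, v, (x %% N)%N, (x %% N)%N; split=> //; nia.
have [y [z [t [yA zA zy [t1 e]]]]] := covered_carry rN (A_cover _ rN rNA).
(* A carry with quotient 0 would give 2y - z = x + N, while y < x and y < N. *)
have tq : (t <= x %/ N)%N.
  have := AN y yA; have := Ax y yA; nia.
have [u [v [vu euv]]] := ternary_cover (x %/ N - t)%N.
exists u, v, y, z; split=> //; have := ternary_leq vu; nia.
Qed.

End ModularSet.

Lemma modular_stanleyE (N : nat) (A : {fset nat}) (a : nat -> nat) :
  modular_set N A -> stanley A a -> a =1 digit_expansion N A.
Proof.
move=> A_mod; have m0 := modular_card_gt0 A_mod.
apply: stanley_unique => //.
- by move=> n nm; rewrite /digit_expansion divn_small // modn_small // muln0.
- exact: digit_expansion_homo.
- exact: digit_expansion_three_free.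
- exact: digit_expansion_cover.
Qed.

(** * Growth of the numbers without digit 2 *)

Local Open Scope ring_scope.

Local Notation log2_3 := (ln 3 / ln 2).

(** Both [w + h] and [w + k] are convex combinations of [w] and [w + h + k],
    with complementary weights, so this is the sum of two instances of convexity. *)
Lemma powR_increment_le (R : realType) (p w h k : R) :
  1 <= p -> 0 <= w -> 0 <= h -> 0 <= k ->
  (w + h) `^ p + (w + k) `^ p <= w `^ p + (w + h + k) `^ p.
Proof.
move=> p1 w0 h0 k0.
have [hk_eq0|hk_neq0] := eqVneq (h + k) 0.
  have [-> ->] : h = 0 /\ k = 0 by split; lra.
  by rewrite !addr0.
have conv (t : R) (t01 : 0 <= t <= 1) : (t * w + (1 - t) * (w + h + k)) `^ p <=
    t * w `^ p + (1 - t) * (w + h + k) `^ p.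
  have /andP[t0 t1] := t01.
  have := @convex_powR R p p1 (Itv01 t0 t1) w (w + h + k).
  by rewrite !inE /= !in_itv /= !andbT !convRE; apply; lra.
have hk_gt0 : 0 < h + k by rewrite lt_def hk_neq0; lra.
pose s := h / (h + k).
have s01 : 0 <= s <= 1 by rewrite ler_pdivlMr // ler_pdivrMr // mul0r h0; lra.
have s01' : 0 <= 1 - s <= 1 by lra.
have := lerD (conv _ s01) (conv _ s01').
have -> : s * w + (1 - s) * (w + h + k) = w + k by rewrite /s; field.
have -> : (1 - s) * w + (1 - (1 - s)) * (w + h + k) = w + h by rewrite /s; field.
lra.
Qed.

Section Growth.
Variable R : realType.

Lemma log2_3_ge1 : 1 <= log2_3 :> R.
Proof.
by rewrite ler_pdivlMr ?ln_gt0 ?mul1r ?ltr1n // ler_ln ?posrE ?ltr0n // ler_nat.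
Qed.

Lemma powR_2_log2_3 : 2 `^ log2_3 = 3 :> R.
Proof.
have ln2 : ln 2 != 0 :> R by rewrite gt_eqF // ln_gt0 // ltr1n.
by rewrite /powR pnatr_eq0 /= divfK // lnK // posrE.
Qed.

(** By induction on halves; an odd digit uses x^L + 1 <= (x + 1)^L. *)
Lemma ternary_le_powR (n : nat) : (ternary n)%:R <= n%:R `^ log2_3 :> R.
Proof.
have log2_3_neq0 : log2_3 != 0 :> R by rewrite gt_eqF // (lt_le_trans ltr01) // log2_3_ge1.
elim/ltn_ind: n => n IH; have [->|n0] := posnP n; first by rewrite powR0.
have half_le : 3 * (ternary n./2)%:R <= (n./2.*2)%:R `^ log2_3 :> R.
  rewrite -muln2 natrM powRM // powR_2_log2_3 mulrC ler_wpM2r //.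
  by apply: IH; lia.
rewrite ternaryE natrD natrM; apply: (le_trans (lerD (lexx _) half_le)).
rewrite -[in leRHS](odd_double_half n) natrD.
case: (odd n); last by rewrite !add0r.
have := @powR_increment_le R _ 0 1 (n./2.*2)%:R log2_3_ge1 (lexx _) ler01 (ler0n _ _).
by rewrite !add0r powR0 // add0r powR1.
Qed.

(** Put T(n) = 2 t(n) + 1.  Then T(2q+1) = 3 T(q) matches (2q+2)^L = 3 (q+1)^L
    exactly, and T(2q) = 3 T(q) - 2 needs (n + 2)^L - (n + 1)^L >= 2 for n = 2q:
    increments of x^L grow, and the one from 1 to 2 equals 3 - 1. *)
Lemma powR_le_ternary (n : nat) : n.+1%:R `^ log2_3 <= 2 * (ternary n)%:R + 1 :> R.
Proof.
elim/ltn_ind: n => n IH; have [->|n0] := posnP n.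
  by rewrite powR1 mulr0 add0r.
have half_le : (n./2.+1.*2)%:R `^ log2_3 <= 3 * (2 * (ternary n./2)%:R + 1) :> R.
  rewrite -muln2 natrM powRM // powR_2_log2_3 mulrC ler_wpM2l //.
  by apply: IH; lia.
rewrite ternaryE natrD natrM.
have [n_odd|n_even] := boolP (odd n).
  have -> : n.+1 = n./2.+1.*2 by lia.
  by apply: (le_trans half_le) => /=; lra.
have en : n./2.+1.*2 = n.+2 by lia.
(* The increments compared are those from 1 to 2 and from n + 1 to n + 2. *)
have := @powR_increment_le R _ 1 n%:R 1 log2_3_ge1 ler01 (ler0n _ _) ler01.
have -> : 1 + n%:R + 1 = n./2.+1.*2%:R :> R by rewrite en -!natr1; ring.
rewrite powR1 powR_2_log2_3.
rewrite (_ : 1 + n%:R = n.+1%:R); last by rewrite -natr1 addrC.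
rewrite /=; lra.
Qed.

Lemma powR_log2_3_le (x y : R) : 0 <= x -> x <= y -> x `^ log2_3 <= y `^ log2_3.
Proof.
move=> x0 xy; apply: ge0_ler_powR => //; rewrite ?nnegrE //.
  exact: le_trans ler01 log2_3_ge1.
exact: le_trans xy.
Qed.

End Growth.

(** * Lower and upper limits *)

Lemma le_limn_esup (R : realType) (u v : (\bar R)^nat) :
  (\forall n \near \oo, (u n <= v n)%E) -> (limn_esup u <= limn_esup v)%E.
Proof.
move=> [k _ uv]; rewrite !limn_esup_lim.
apply: lee_lim; [exact: is_cvg_esups|exact: is_cvg_esups|].
exists k => // n /= kn; apply: ge_ereal_sup => _ [i /= ni <-].
apply: (le_trans (uv i _)); first exact: leq_trans ni.
by apply: ereal_sup_ubound; exists i.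
Qed.

Lemma le_limn_einf (R : realType) (u v : (\bar R)^nat) :
  (\forall n \near \oo, (u n <= v n)%E) -> (limn_einf u <= limn_einf v)%E.
Proof.
move=> uv; rewrite -leeN2 -!limn_esupN; apply: le_limn_esup.
by apply: filterS uv => n /=; rewrite leeN2.
Qed.

Lemma cvg_add_div_nat (R : realType) (x y : R) :
  (x + y / n%:R)%:E @[n --> \oo] --> x%:E.
Proof.
apply: cvg_EFin; first exact: nearW.
rewrite -[X in _ --> X]addr0; apply: cvgD; first exact: cvg_cst.
rewrite -[X in _ --> X](mulr0 y); apply: cvgM; first exact: cvg_cst.
apply/gtr0_cvgV0; last exact: cvgr_idn.
by exists 1%N => // n /=; rewrite ltr0n.
Qed.

Theorem corollary2p6 (R : realType) (N : nat) (a : nat -> nat) :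
  (0 < N)%N -> modular_stanley N a -> type1_growth R a.
Proof.
move=> N_gt0 [A [A_mod /(modular_stanleyE A_mod) aE]].
set m := #|` A |.
have m_gt0 : (0 < m)%N := modular_card_gt0 A_mod.
have N0 : 0 < N%:R :> R by rewrite ltr0n.
have mL_gt0 : 0 < m%:R `^ log2_3 :> R by rewrite powR_gt0 // ltr0n.
pose alpha : R := N%:R / m%:R `^ log2_3.
have nL_ge n : (0 < n)%N -> n%:R <= n%:R `^ log2_3 :> R.
  by move=> n0; apply: le1r_powR (log2_3_ge1 R); rewrite ler1n.
have a_ge n : N%:R * (ternary (n %/ m))%:R <= (a n)%:R :> R.
  by rewrite -natrM ler_nat aE leq_addr.
have a_le n : (a n)%:R <= N%:R * (ternary (n %/ m))%:R + N%:R :> R.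
  rewrite -natrM -natrD ler_nat aE leq_add2l ltnW //.
  by have [_ AN _ _] := A_mod; apply/AN/modular_nth_mem; rewrite ltn_mod.
have alphaE n : alpha * n%:R `^ log2_3 = N%:R * (n%:R / m%:R) `^ log2_3 :> R.
  rewrite powRM // ?invr_ge0 // -(powR_inv1 (ler0n R m)) powRAC powR_inv1 ?powR_ge0 //.
  by rewrite /alpha; ring.
(* The error N / n^L is weakened to N / n, whose limit is readily available. *)
have ratio_le n : (0 < n)%N -> growth_ratio R a n <= alpha + N%:R / n%:R.
  move=> n_gt0; have n0 : 0 < n%:R :> R by rewrite ltr0n.
  have nL_gt0 := lt_le_trans n0 (nL_ge n n_gt0).
  rewrite ler_pdivrMr // mulrDl alphaE; apply: (le_trans (a_le n)); apply: lerD.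
    rewrite ler_wpM2l // (le_trans (ternary_le_powR _ _)) //.
    apply: powR_log2_3_le; first by rewrite ?divr_ge0.
    by rewrite ler_pdivlMr ?ltr0n // -natrM ler_nat leq_divM.
  by rewrite mulrAC -mulrA ler_peMr // ler_pdivlMr // mul1r nL_ge.
have ratio_ge n : (0 < n)%N -> alpha / 2 - N%:R / n%:R <= growth_ratio R a n.
  move=> n_gt0; have n0 : 0 < n%:R :> R by rewrite ltr0n.
  have nL_gt0 := lt_le_trans n0 (nL_ge n n_gt0).
  rewrite ler_pdivlMr //; apply: le_trans (a_ge n).
  have : N%:R <= N%:R / n%:R * n%:R `^ log2_3 :> R.
    by rewrite mulrAC -mulrA ler_peMr // ler_pdivlMr // mul1r nL_ge.
  have : N%:R * (n%:R / m%:R) `^ log2_3 <= N%:R * (2 * (ternary (n %/ m))%:R + 1) :> R.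
    rewrite ler_wpM2l // (le_trans _ (powR_le_ternary _ _)) //.
    apply: powR_log2_3_le; first by rewrite ?divr_ge0.
    by rewrite ler_pdivrMr ?ltr0n // -natrM ler_nat ltnW // ltn_ceil.
  by rewrite -alphaE; lra.
exists alpha; split; first by rewrite divr_gt0.
split; last split.
- have [<- _] := cvg_limn_einf_sup (@cvg_add_div_nat R (alpha / 2) (- N%:R)).
  apply: le_limn_einf; exists 1%N => // n /= n1.
  by rewrite lee_fin mulNr ratio_ge.
- exact: limn_einf_sup.
- have [_ <-] := cvg_limn_einf_sup (@cvg_add_div_nat R alpha N%:R).
  by apply: le_limn_esup; exists 1%N.
Qed.
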